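(* Let $N,k$ be positive integers with $N\ge 2k+1$, let $G$ be a connected $r$-regular graph on $m$ vertices, and let $X=C_N^k\square G$. For $a,b\in V(G)$ and $0\le\ell\le N-1$, $$h_X((0,a),(\ell,b))=\frac{2k+r}{2k}h_{C_N^k}(0,\ell)+\frac{m(2k+r)}{2}\sum_{\alpha=1}^{t}\sum_{j=0}^{N-1}\frac{E_\alpha(b,b)-E_\alpha(a,b)\cos(\ell\theta_j)}{D_{k,\nu_\alpha}(2\cos\theta_j)}.$$
   Context: All graphs are finite, simple and undirected; $\mathbb Z_N=\mathbb Z/N\mathbb Z$. $C_N^k$ is the graph with vertex set $\mathbb Z_N$ in which $x,y$ are adjacent iff $x-y\equiv\pm s\pmod N$ for some $1\le s\le k$ (it is $2k$-regular since $N\ge 2k+1$). $X=C_N^k\square G$ is the Cartesian product: vertex set $\mathbb Z_N\times V(G)$, with $(x,a)$ and $(y,b)$ adjacent iff ($a=b$ and $x,y$ are adjacent in $C_N^k$) or ($x=y$ and $a,b$ are adjacent in $G$). For a finite connected graph $Y$ and $u,v\in V(Y)$, $h_Y(u,v)$ is the expected value of $T_v=\inf\{t\ge 0: Z_t=v\}$ for the simple random walk $(Z_t)$ on $Y$ started at $u$ (each step moves to a uniformly random neighbour). $\theta_j=2\pi j/N$. $L_G=rI_m-A_G$ is the Laplacian of $G$, with distinct eigenvalues $0=\nu_0<\nu_1<\cdots<\nu_t$; $E_\alpha$ is the orthogonal projection onto the $\nu_\alpha$-eigenspace, with entries $E_\alpha(a,b)$. For $\nu>0$, $D_{k,\nu}(x)=k+\frac{\nu}{2}-\sum_{s=1}^{k}T_s\left(\frac{x}{2}\right)$,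 where $T_s$ is the Chebyshev polynomial of the first kind. *)

(* Defs.v *)
From HB Require Import structures.
From mathcomp Require Import all_boot all_order all_algebra.
From mathcomp Require Import all_classical all_reals all_analysis.

Set Implicit Arguments.
Unset Strict Implicit.
Unset Printing Implicit Defensive.

Import Order.TTheory GRing.Theory Num.Theory.
Import numFieldNormedType.Exports.

Local Open Scope classical_set_scope.
Local Open Scope ring_scope.

Section Graphs.
Variables (V : finType) (e : rel V).

Definition simple_graph := symmetric e /\ irreflexive e.

Definition degree (x : V) : nat := #|e x|.

Definition regular_graph (r : nat) := forall x, degree x = r.

Definition connected_graph := forall x y, connect e x y.

End Graphs.

(* Used only for 2k+1 <= N with k > 0, so that N > 1 and 'Z_N is Z/NZ. *)
Definition circulant (N k : nat) : rel 'Z_N := fun x y =>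
  [exists s : 'I_k.+1, (0 < s)%N && ((x - y == s%:R) || (x - y == - s%:R))].

Definition cartesian_product (V W : finType) (e : rel V) (f : rel W) :
    rel (V * W) := fun u v =>
  ((u.2 == v.2) && e u.1 v.1) || ((u.1 == v.1) && f u.2 v.2).

Section RandomWalk.
Context {d : measure_display} {Omega : measurableType d} {R : realType}.
Variables (V : finType) (e : rel V).

Definition transition (x y : V) : R :=
  if e x y then ((degree e x)%:R)^-1 else 0.

(* The last clause is the Markov property
     P (Z_{n+1} = x_{n+1} | Z_0 = x_0, ..., Z_n = x_n) = p(x_n, x_{n+1})
   multiplied out, so that it makes sense for null histories too. *)
Definition simple_random_walk (P : probability Omega R) (Z : nat -> Omega -> V)
    (u : V) : Prop :=
  [/\ forall n v, measurable (Z n @^-1` [set v]),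
      P [set w | Z 0%N w = u] = 1%E
    & forall (n : nat) (x : nat -> V),
        P [set w | forall i, (i <= n.+1)%N -> Z i w = x i] =
        (P [set w | forall i, (i <= n)%N -> Z i w = x i] *
         (transition (x n) (x n.+1))%:E)%E].

(* Extended-real valued: +oo on the trajectories that never visit v. *)
Definition first_visit (Z : nat -> Omega -> V) (v : V) (w : Omega) : \bar R :=
  ereal_inf [set (t%:R)%:E | t in [set t : nat | Z t w = v]].

Definition hitting_time (P : probability Omega R) (Z : nat -> Omega -> V)
    (v : V) : \bar R :=
  (\int[P]_w first_visit Z v w)%E.

End RandomWalk.

Definition laplacian (R : realType) (V : finType) (e : rel V) (r : nat) :
    'M[R]_#|V| :=
  (r%:R)%:M - \matrix_(i, j) (e (enum_val i) (enum_val j))%:R.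

Definition distinct_eigenvalues (R : realType) (n : nat) (L : 'M[R]_n)
    (t : nat) (nu : 'I_t.+1 -> R) : Prop :=
  (forall i j : 'I_t.+1, (i < j)%N -> nu i < nu j) /\
  (forall x : R, eigenvalue L x <-> exists i, x = nu i).

(* Orthogonal projection onto the row space of U for the standard inner
   product: the row space of kermx U^T is the orthogonal complement of that
   of U.  Over numClosedFieldType this is spectral.proj_ortho. *)
Definition orthoproj (R : realType) (p n : nat) (U : 'M[R]_(p, n)) : 'M[R]_n :=
  proj_mx <<U>>%MS (kermx U^T).

Lemma kermx_tr_disj (R : realType) (p n : nat) (U : 'M[R]_(p, n)) :
  (<<U>> :&: kermx U^T = 0)%MS.
Proof.
apply/eqP/rowV0P => v; rewrite sub_capmx genmxE => /andP[/submxP[w ->]].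
move/sub_kermxP => h; set x := w *m U in h *.
have : x *m x^T = 0 by rewrite {2}/x trmx_mul mulmxA h mul0mx.
move/matrixP/(_ 0 0); rewrite !mxE => /eqP.
rewrite psumr_eq0 => [/allP x0|i _]; last by rewrite [x^T _ _]mxE -expr2 sqr_ge0.
apply/rowP => i; rewrite [RHS]mxE.
by have := x0 i (mem_index_enum i); rewrite [x^T _ _]mxE -expr2 sqrf_eq0 => /eqP.
Qed.

Lemma orthoprojP (R : realType) (p n : nat) (U : 'M[R]_(p, n)) (u : 'rV[R]_n) :
  (u *m orthoproj U <= U)%MS /\ (u - u *m orthoproj U) *m U^T = 0.
Proof.
split; first by rewrite (submx_trans (proj_mx_sub _ _ _)) ?genmxE.
apply/sub_kermxP; apply: proj_mx_compl_sub.
suff /eqP full : \rank (<<U>> + kermx U^T)%MS == n.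
  by apply: submx_full; rewrite /row_full full.
have := mxrank_sum_cap <<U>>%MS (kermx U^T).
rewrite kermx_tr_disj mxrank0 addn0 => ->.
by rewrite mxrank_gen mxrank_ker mxrank_tr subnKC // rank_leq_col.
Qed.

Fixpoint chebyshev_pair (R : realType) (n : nat) : {poly R} * {poly R} :=
  if n is n'.+1 then
    let: (p, q) := chebyshev_pair R n' in (q, 2%:R *: 'X * q - p)
  else (1, 'X).

(* The pair recursion carries (T_n, T_{n+1}), where T_0 = 1, T_1 = X and
   T_{n+2} = 2 X T_{n+1} - T_n. *)
Definition chebyshev (R : realType) (n : nat) : {poly R} :=
  (chebyshev_pair R n).1.

Definition Dpol (R : realType) (k : nat) (nu x : R) : R :=
  k%:R + nu / 2 - \sum_(1 <= s < k.+1) (chebyshev R s).[x / 2].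

(* Main.v *)
(* If g vanishes at v and satisfies g = 1 + P g off v, P being the transition
   operator, then the expected hitting time of v from u is g(u).  Indeed, with
   q_n(x) the probability of being at x at time n without having met v,
   the partial sums of the P(T_v > i) telescope to g(u) - sum_x q_n(x) g(x);
   they are therefore bounded, so P(T_v > n) and the remainder tend to 0.

   Such a g is explicit for both graphs: the Fourier modes cos(z theta_j) on Z_N
   and the spectral projections E_i of L_G diagonalise the two Laplacians, and
   their products are eigenfunctions on C_N^k [] G with eigenvalue 2 D_{k,nu_i}.
   The identities sum_j cos(z theta_j) = N [z = 0] and
   sum_{i>0} E_i(c,b) = [c = b] - 1/m turn the double sum into a solution of
   the hitting time equation. *)

Require Import Defs.
From HB Require Import structures.
From mathcomp Require Import all_boot all_order all_algebra.
From mathcomp Require Import all_classical all_reals all_analysis.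
From mathcomp Require Import measurable_realfun.
From mathcomp Require Import complex spectral sesquilinear ring zify.

Set Implicit Arguments.
Unset Strict Implicit.
Unset Printing Implicit Defensive.

Import Order.TTheory GRing.Theory Num.Theory.
Import numFieldNormedType.Exports.

Local Open Scope classical_set_scope.
Local Open Scope ring_scope.

(** * Expected hitting times from solutions of the one-step equation *)

Section HittingTime.
Context {d : measure_display} {Omega : measurableType d} {R : realType}.
Context {V : finType}.

Definition avoids (Z : nat -> Omega -> V) (v : V) (n : nat) : set Omega :=
  [set w | forall i, (i <= n)%N -> Z i w <> v].

(** Since [avoids Z v n] is the event $T_v>n$, this is the layer-cake formula for $T_v$; on a
    trajectory missing [v] every indicator is 1 and both sides are $+\infty$. *)
Lemma first_visitE (Z : nat -> Omega -> V) (v : V) (w : Omega) :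
  first_visit Z v w =
  (\sum_(n <oo) (\1_(avoids Z v n) w : R)%:E)%E.
Proof.
have H n : (\1_(avoids Z v n) w : R) = (~~ [exists i : 'I_n.+1, Z i w == v])%:R.
  rewrite indicE; congr (nat_of_bool _)%:R; apply/idP/idP.
    rewrite inE => A; apply/existsP => -[i /eqP]; apply: A.
    by rewrite -ltnS.
  move=> /existsPn A; rewrite inE /= => i im; apply/eqP.
  by have := A (Ordinal (im : (i < n.+1)%N)).
have [[s /eqP Zs]|nv] := pselect (exists s, Z s w = v); last first.
  rewrite /first_visit (_ : [set _ | _ in _] = set0); last first.
    by rewrite -subset0 => x [s Zs _]; apply: nv; exists s.
  rewrite ereal_inf0; apply/esym/cvg_lim => //.
  have -> : (fun n => \sum_(0 <= i < n) (\1_(avoids Z v i) w : R)%:E)%E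
            = (fun n => n%:R%:E).
    apply/funext => n; rewrite (eq_bigr (fun=> 1%:E)).
      by rewrite sumEFin big_const_nat subn0 iter_addr_0.
    move=> i _; rewrite H; case: existsP => // -[j /eqP Zj].
    by case: nv; exists j.
  exact/cvgenyP/cvg_id.
have ex : exists n, Z n w == v by exists s.
pose t := ex_minn ex.
have [Zt tmin] : Z t w = v /\ forall n, Z n w = v -> (t <= n)%N.
  by rewrite /t; case: ex_minnP => n /eqP ? h; split=> // i /eqP; exact: h.
have -> : first_visit Z v w = t%:R%:E :> \bar R.
  apply/eqP; rewrite eq_le; apply/andP; split.
    by apply: ge_ereal_inf; exists t%:R%:E => //; exists t.
  by apply: le_ereal_inf_tmp => _ [n Zn <-]; rewrite lee_fin ler_nat tmin.
have ind n : (\1_(avoids Z v n) w : R) = (n < t)%N%:R.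
  rewrite H; congr (nat_of_bool _)%:R.
  rewrite ltnNge; congr (~~ _); apply/existsP/idP.
    by case=> i /eqP /tmin /leq_trans; apply; rewrite -ltnS.
  by move=> tn; exists (Ordinal (tn : (t < n.+1)%N)); rewrite /= Zt.
apply/esym/(lim_near_cst (@ereal_hausdorff R)).
exists t => // n /= tn; rewrite (big_cat_nat (leq0n t) tn) //=
  [X in (_ + X)%E]big1_seq.
  rewrite adde0 big_nat (eq_bigr (fun=> 1%:E)).
    by rewrite -big_nat sumEFin big_const_nat subn0 iter_addr_0.
  by move=> i /= it; rewrite ind it.
by move=> i /=; rewrite mem_index_iota => /andP[ti _]; rewrite ind ltnNge ti.
Qed.

(** Serves to split an event along the current state or along a finite history, both of which take
    finitely many values. *)
Lemma probability_fibers (P : probability Omega R) (T : finType)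
    (h : Omega -> T) (B : set Omega) :
  (forall t, measurable (h @^-1` [set t])) -> measurable B ->
  P B = (\sum_(t : T) P (B `&` h @^-1` [set t]))%E.
Proof.
move=> mh mB; have eT : [set` enum T] = setT :> set T.
  by rewrite -subTset => t _; rewrite /= mem_enum.
have {1}-> : B = \bigcup_(t in setT) (B `&` h @^-1` [set t]).
  by apply/seteqP; split=> [w Bw|w [t _ []]//]; exists (h w).
rewrite measure_fin_bigcup //=.
- by rewrite -eT -fsbig_seq ?enum_uniq // big_enum.
- apply/trivIsetP => s t _ _ /eqP st; rewrite -subset0 => w [[_ hs] [_ ht]].
  by case: st; rewrite -hs -ht.
- by move=> t _; exact: measurableI.
Qed.

Section Walk.
Variables (e : rel V) (P : probability Omega R).
Variables (Z : nat -> Omega -> V) (u v : V).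
Hypothesis walkZ : simple_random_walk e P Z u.

Let measurableZ n (x : V) : measurable (Z n @^-1` [set x]).
Proof. by case: walkZ. Qed.

Lemma measurable_avoids n : measurable (avoids Z v n).
Proof.
have -> : avoids Z v n =
    \bigcap_(i in [set i | (i <= n)%N]) ~` (Z i @^-1` [set v]).
  by [].
apply: bigcap_measurable; first by exists 0%N => /=.
by move=> i _; apply: measurableC.
Qed.

Lemma measurable_at n x : measurable (avoids Z v n `&` Z n @^-1` [set x]).
Proof. by apply: measurableI => //; exact: measurable_avoids. Qed.

(** This is $q_n(x)$, the law at time [n] of the walk killed at [v]. *)
Definition survive (n : nat) (x : V) : R :=
  fine (P (avoids Z v n `&` Z n @^-1` [set x])).

Lemma surviveE n x :
  P (avoids Z v n `&` Z n @^-1` [set x]) = (survive n x)%:E.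
Proof. by rewrite fineK // fin_num_measure //; exact: measurable_at. Qed.

(** The Markov property is given for whole trajectories only, so both events are split along the
    histories $(Z_0,\dots,Z_n)$ and compared history by history. *)
Lemma survive_step n x y :
  P (avoids Z v n `&` Z n @^-1` [set x] `&` Z n.+1 @^-1` [set y]) =
  (survive n x * transition e x y)%:E.
Proof.
pose h w := [ffun i : 'I_n.+1 => Z i w].
have mh f : measurable (h @^-1` [set f]).
  have -> : h @^-1` [set f] =
      \bigcap_(i in [set i | (i <= n)%N]) (Z i @^-1` [set f (inord i)]).
    apply/seteqP; split=> w /= => [<- i /= i_n|Zf].
      by rewrite ffunE inordK.
    apply/ffunP => i; rewrite ffunE (Zf i) ?inord_val //.
    by rewrite /= -ltnS.
  by apply: bigcap_measurable => //; exists 0%N.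
have mA := measurable_at n x.
rewrite EFinM -surviveE (probability_fibers P mh) ?(probability_fibers P mh mA).
- rewrite ge0_sume_distrl //; apply: eq_bigr => f _.
  (* A history that does not end at [x], or that meets [v], contributes the empty set to both
     sides. *)
  have [/andP[fx /forallP fv]|nf] :=
      boolP ((f ord_max == x) && [forall i, f i != v]); last first.
    rewrite (_ : _ `&` h @^-1` _ = set0); last first.
      rewrite -subset0 => w [[[av Zx] _] hf].
      case/negP: nf; rewrite -hf ffunE /= Zx eqxx; apply/forallP => i.
      by rewrite ffunE; apply/eqP/av; rewrite -ltnS.
    rewrite (_ : _ `&` h @^-1` _ = set0); last first.
      rewrite -subset0 => w [[av Zx] hf].
      case/negP: nf; rewrite -hf ffunE /= Zx eqxx; apply/forallP => i.
      by rewrite ffunE; apply/eqP/av; rewrite -ltnS.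
    by rewrite measure0 mul0e.
  (* The Markov clause takes a sequence on all of [nat], so the history [f] is continued by the
     constant [y]. *)
  pose s i := if (i <= n)%N then f (inord i) else y.
  have hs w : (forall i, (i <= n)%N -> Z i w = s i) <-> h w = f.
    split=> [Zs|hf i i_n]; last by rewrite /s i_n -hf ffunE inordK.
    apply/ffunP => i; have i_n : (i <= n)%N by rewrite -ltnS.
    by rewrite ffunE Zs // /s i_n inord_val.
  have ew w : h w = f -> (avoids Z v n `&` Z n @^-1` [set x]) w.
    move=> hf; split => [i i_n|] /=.
      have -> : Z i w = h w (inord i) by rewrite ffunE inordK.
      by rewrite hf; exact/eqP/fv.
    have -> : Z n w = h w ord_max by rewrite ffunE.
    by rewrite hf; exact/eqP.
  have [_ _ /(_ n s)] := walkZ.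
  have -> : s n = x.
    by rewrite /s leqnn -(eqP fx); congr (f _); exact/val_inj/inordK.
  have -> : s n.+1 = y by rewrite /s ltnn.
  have -> : [set w | forall i, (i <= n)%N -> Z i w = s i] = 
     avoids Z v n `&` Z n @^-1` [set x] `&` h @^-1` [set f].
    apply/seteqP; split=> w /=; first by move/hs => hf; split => //; exact: ew.
    by case=> _ hf; exact/hs.
  move<-; congr (P _); apply/seteqP; split=> w /=.
    case=> -[_ Zy] hf i; rewrite leq_eqVlt => /predU1P[->|].
      by rewrite Zy /s ltnn.
    by rewrite ltnS; exact: (hs w).2.
  move=> Zs; have hf : h w = f by apply/hs => i i_n; apply: Zs; exact: leqW.
  split=> //; split; first exact: ew.
  by rewrite Zs // /s ltnn.
- exact: measurableI.
Qed.

Lemma probability_avoids n : P (avoids Z v n) = (\sum_x survive n x)%:E.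
Proof.
rewrite (probability_fibers P (measurableZ n) (measurable_avoids n)).
by rewrite -sumEFin; apply: eq_bigr => x _; rewrite surviveE.
Qed.

Lemma survive_target n : survive n v = 0.
Proof.
rewrite /survive (_ : _ `&` _ = set0) ?measure0 // -subset0 => w [av].
exact: av.
Qed.

(** As [y] differs from [v], standing at [y] at time [n.+1] prolongs the avoidance of [v] by one
    step; splitting along [Z n] then gives the recursion. *)
Lemma survive_recr n y : y != v ->
  survive n.+1 y = \sum_x survive n x * transition e x y.
Proof.
move=> yv; apply: EFin_inj; rewrite -surviveE -sumEFin.
have -> : avoids Z v n.+1 `&` Z n.+1 @^-1` [set y] =
          avoids Z v n `&` Z n.+1 @^-1` [set y].
  apply/seteqP; split=> w [av Zy]; split=> // i i_n; first exact/av/leqW.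
  by move: i_n; rewrite leq_eqVlt => /predU1P[->|/av//]; rewrite Zy; exact/eqP.
rewrite (probability_fibers P (measurableZ n)); last first.
  by apply: measurableI => //; exact: measurable_avoids.
by apply: eq_bigr => x _; rewrite setIAC survive_step.
Qed.

Lemma survive0 x : survive 0 x = ((x != v) && (x == u))%:R.
Proof.
have [->|xv] /= := eqVneq x v; first exact: survive_target.
have [_ Pu _] := walkZ; have [eq_xu|xu] := eqVneq x u.
  rewrite eq_xu in xv *; apply: EFin_inj; rewrite -surviveE -Pu; congr (P _).
  apply/seteqP; split=> [w []//|w Zu]; split=> // i.
  by rewrite leqn0 => /eqP -> /=; rewrite Zu; apply/eqP.
apply: EFin_inj; rewrite -surviveE; apply/eqP; rewrite -measure_le0.
(* For [x] other than [u] the event lies in the complement of the almost sure event $Z_0=u$. *)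
have <- : P (~` [set w | Z 0%N w = u]) = 0%E.
  rewrite probability_setC; last exact: (measurableZ 0 u).
  by rewrite Pu subee.
apply: le_measure; rewrite ?inE.
- exact: measurable_at.
- by apply: measurableC; exact: (measurableZ 0 u).
- by move=> w [_ /= ->]; exact/eqP.
Qed.

(** The series of [first_visitE] has nonnegative terms and can be integrated term by term. *)
Lemma hitting_time_tail :
  hitting_time P Z v = (\sum_(n <oo) (\sum_x survive n x)%:E)%E.
Proof.
rewrite /hitting_time (eq_integral _ _ (fun w _ => first_visitE Z v w)).
rewrite integral_nneseries //.
- apply: eq_eseriesr => n _.
  rewrite integral_indic //; last exact: measurable_avoids.
  by rewrite setIT; exact: probability_avoids.
- move=> n; apply/measurable_EFinP/measurable_indic.
  exact: measurable_avoids.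
Qed.

Variable g : V -> R.
Hypothesis gv : g v = 0.
Hypothesis g_step : forall x, x != v -> g x = 1 + \sum_y transition e x y * g y.

(** One step of the killed walk lowers $\sum_x q_n(x)g(x)$ by exactly $\sum_x q_n(x)$: the equation
    for [g] holds wherever $q_n$ is nonzero, and the mass absorbed at [v] carries weight
    $g(v)=0$. *)
Lemma survive_telescope n :
  \sum_(0 <= i < n) \sum_x survive i x = g u - \sum_x survive n x * g x.
Proof.
elim: n => [|n IHn].
  rewrite big_geq // (bigD1 u) //= survive0 eqxx andbT big1 => [|x /negPf xu].
    rewrite addr0; have [->|_] := eqVneq u v;
      by rewrite ?gv /= ?mulr0 ?mul1r subrr.
  by rewrite survive0 xu andbF mul0r.
rewrite big_nat_recr //= IHn -addrA; congr (_ + _).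
suff -> : \sum_x survive n.+1 x * g x =
    \sum_x (survive n x * g x - survive n x) by rewrite sumrB opprB addrC.
transitivity (\sum_y \sum_x survive n x * transition e x y * g y).
  apply: eq_bigr => y _; rewrite -mulr_suml.
  by have [->|yv] := eqVneq y v; rewrite ?gv ?mulr0 // survive_recr.
rewrite exchange_big; apply: eq_bigr => x _.
have [->|xv] := eqVneq x v.
  by rewrite survive_target mul0r subrr big1 // => y _; rewrite !mul0r.
rewrite g_step // mulrDr mulr1 addrAC subrr add0r mulr_sumr.
by apply: eq_bigr => y _; rewrite mulrA.
Qed.

Lemma hitting_time_solution : hitting_time P Z v = (g u)%:E.
Proof.
pose p n := \sum_x survive n x.
have p0 n : 0 <= p n by rewrite -lee_fin -probability_avoids.
have p1 n : p n <= 1.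
  rewrite -lee_fin -probability_avoids probability_le1 //.
  exact: measurable_avoids.
have s0 n x : 0 <= survive n x by rewrite fine_ge0.
have bnd n : `|\sum_x survive n x * g x| <= p n * \sum_x `|g x|.
  rewrite mulr_suml (le_trans (ler_norm_sum _ _ _)) //; apply: ler_sum => x _.
  rewrite normrM ger0_norm // ler_wpM2l //.
  by rewrite (bigD1 x) //= lerDl sumr_ge0.
have cvg_p : cvgn (series p).
  apply: nondecreasing_is_cvgn.
    by apply/nondecreasing_seqP => n; rewrite /series /= big_nat_recr //= lerDl.
  exists (`|g u| + \sum_x `|g x|) => _ [n _ <-].
  rewrite /series /= survive_telescope (le_trans (ler_norm _)) //.
  rewrite (le_trans (ler_normB _ _)) // lerD2l (le_trans (bnd n)) //.
  by rewrite ler_piMl // sumr_ge0.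
have rem0 : \sum_x survive n x * g x @[n --> \oo] --> (0 : R).
  apply/norm_cvg0P.
  have bnd0 : p n * \sum_x `|g x| @[n --> \oo] --> (0 : R).
    rewrite -[X in _ --> X](mul0r (\sum_x `|g x|)); apply: cvgM (cvg_cst _).
    exact: cvg_series_cvg_0 cvg_p.
  apply: squeeze_cvgr (cvg_cst 0) bnd0.
  by near=> n; rewrite /= normr_ge0 bnd.
rewrite hitting_time_tail; apply/cvg_lim => //.
under eq_fun do rewrite sumEFin survive_telescope.
apply: cvg_EFin; first by near=> n.
rewrite -[X in _ --> X]subr0; exact: (cvgB (cvg_cst _) rem0).
Unshelve. all: by end_near. Qed.
End Walk.
End HittingTime.

(** * Spectral decomposition of real symmetric matrices *)

Lemma symmetric_eigenspaces_full (R : rcfType) n (A : 'M[R]_n) :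
  A^T = A -> exists2 rs, uniq rs & (\sum_(x <- rs) eigenspace A x :=: 1%:M)%MS.
Proof.
case: n A => [|n] A symA.
  by exists [::] => //; rewrite big_nil [1%:M]thinmx0; exact: eqmx_refl.
apply/diagonalizablePeigen/diagonalizableP.
(* Over the complex numbers the matrix is hermitian, hence unitarily diagonalisable with real
   spectrum; the factorisation of its minimal polynomial is then pulled back to [R]. *)
pose toC : {rmorphism R -> R[i]} := real_complex R.
pose B : 'M[R[i]]_n.+1 := map_mx toC A.
have hermB : B \is hermsymmx.
  apply: realsym_hermsym.
    apply/is_hermitianmxP.
    by rewrite expr0 scale1r map_mx_id // /B map_trmx symA.
  by apply/mxOverP => i j; rewrite mxE; apply/complex_realP; exists (A i j).
have /orthomx_spectralP BE := hermitian_normalmx hermB.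
have realB := hermitian_spectral_diag_real hermB.
pose d i := complex.Re (spectral_diag B 0 i).
have dE i : spectral_diag B 0 i = toC (d i).
  by rewrite /toC /= RRe_real //; exact: (mxOverP realB).
(* The minimal polynomial is invariant under conjugation, and for a diagonal matrix it is the
   product over the distinct entries. *)
have minB : map_poly toC (mxminpoly A) =
    map_poly toC (\prod_(x <- undup [seq d i | i <- enum 'I_n.+1]) ('X - x%:P)).
  rewrite -mxminpoly_map -/B {1}BE -conjVmx ?spectral_unit //.
  rewrite mxminpoly_uconj ?unitmx_inv ?spectral_unit // mxminpoly_diag.
  rewrite (eq_map dE) map_comp undup_map_inj; last exact: complexI.
  rewrite rmorph_prod big_map; apply: eq_bigr => x _.
  by rewrite /= map_polyXsubC.
exists (undup [seq d i | i <- enum 'I_n.+1]); first exact: undup_uniq.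
by rewrite (map_poly_inj toC minB).
Qed.

Section OrthogonalProjection.
Variables (R : realType) (n : nat).
Implicit Type L : 'M[R]_n.

Lemma orthoproj_id p q (U : 'M[R]_(p, n)) (W : 'M[R]_(q, n)) :
  (W <= U)%MS -> W *m orthoproj U = W.
Proof.
by move=> WU; rewrite /orthoproj proj_mx_id ?kermx_tr_disj // genmxE.
Qed.

Lemma orthoproj_0 p q (U : 'M[R]_(p, n)) (W : 'M[R]_(q, n)) :
  W *m U^T = 0 -> W *m orthoproj U = 0.
Proof.
by move=> WU; rewrite /orthoproj proj_mx_0 ?kermx_tr_disj //; exact/sub_kermxP.
Qed.

Lemma orthoproj_sub p (U : 'M[R]_(p, n)) : (orthoproj U <= U)%MS.
Proof. by apply/row_subP => i; rewrite rowE; exact: (orthoprojP U _).1. Qed.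

(** The rows of $1-Q$ are orthogonal to [U] and those of $Q$ lie in its row space, so $(1-Q)Q^T=0$;
    thus $Q^T=QQ^T$, which is symmetric. *)
Lemma orthoproj_sym p (U : 'M[R]_(p, n)) : (orthoproj U)^T = orthoproj U.
Proof.
set Q := orthoproj U.
suff QE : Q^T = Q *m Q^T.
  by have := congr1 trmx QE; rewrite (trmx_mul Q) trmxK -QE.
have [X QX] : exists X, Q = X *m U.
  by apply/submxP; exact: orthoproj_sub.
apply/eqP; rewrite -subr_eq0 -[X in X - _]mul1mx -mulmxBl.
rewrite {2}QX trmx_mul mulmxA (_ : _ *m U^T = 0) ?mul0mx //.
apply/row_matrixP => i; rewrite row_mul linearB row0 /= row1 rowE.
exact: (orthoprojP U (delta_mx 0 i)).2.

Qed.

(** By diagonalisability the identity is a combination $\sum_i u_iU_i$ of eigenspace bases; each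
    projection fixes its own [U i] and kills the others, which are orthogonal to it. *)
Lemma orthoproj_eigenspace_sum L t (nu : 'I_t.+1 -> R) :
  L^T = L -> distinct_eigenvalues L nu ->
  \sum_i orthoproj (eigenspace L (nu i)) = 1%:M.
Proof.
move=> symL [nu_lt nuP]; pose U i := eigenspace L (nu i).
have nu_inj i j : i != j -> nu i != nu j.
  by rewrite neq_ltn => /orP[] /nu_lt /lt_eqF h; rewrite ?h // eq_sym h.
have [rs _ rs1] := symmetric_eigenspaces_full symL.
have /sub_sumsmxP[u uE] : (1%:M <= \sum_i U i)%MS.
  rewrite -rs1; elim/big_rec: _ => [|x W _ WU]; first exact: sub0mx.
  rewrite addsmx_sub WU andbT.
  (* The list [rs] may contain values that are not eigenvalues; their eigenspaces are 0. *)
  have [/nuP[i ->]|] := boolP (eigenvalue L x); first exact: (sumsmx_sup i).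
  by rewrite negbK => /eqP ->; exact: sub0mx.
have UL i : U i *m L = nu i *: U i by exact/eigenspaceP.
rewrite -[LHS]mul1mx [in LHS]uE [RHS]uE mulmx_suml; apply: eq_bigr => i _.
rewrite mulmx_sumr (bigD1 i) //= big1 ?addr0; last first.
  move=> j ji; rewrite orthoproj_0 // -mulmxA (_ : _ *m _^T = 0) ?mulmx0 //.
  (* Computing $U_iLU_j^T$ from the left and from the right yields the two eigenvalues. *)
  have : nu i *: (U i *m (U j)^T) = nu j *: (U i *m (U j)^T).
    by rewrite scalemxAl -UL -mulmxA -{1}symL -trmx_mul UL linearZ /= scalemxAr.
  move/eqP; rewrite -subr_eq0 -scalerBl scaler_eq0 subr_eq0 eq_sym.
  by rewrite (negPf (nu_inj _ _ ji)) => /eqP.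
by rewrite orthoproj_id // submxMl.
Qed.

End OrthogonalProjection.

Definition laplacian_proj (R : realType) (V : finType) (e : rel V) (r : nat)
    (a : R) (x y : V) : R :=
  orthoproj (eigenspace (laplacian R e r) a) (enum_rank x) (enum_rank y).

(** * Laplacian of a connected regular graph and its spectral projections *)

Section Laplacian.
Variables (R : realType) (V : finType) (e : rel V) (r : nat).
Hypothesis simple_e : simple_graph e.
Hypothesis conn_e : connected_graph e.
Hypothesis reg_e : regular_graph e r.

Let sym_e : symmetric e. Proof. by case: simple_e. Qed.

Lemma sum_neighbours_cst (c : R) x : \sum_(y | e x y) c = r%:R * c.
Proof. by rewrite sumr_const mulr_natl; congr (_ *+ _); exact: reg_e. Qed.

Lemma mulmx_laplacian p (A : 'M[R]_(p, #|V|)) i x :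
  (A *m laplacian R e r) i (enum_rank x) =
  r%:R * A i (enum_rank x) - \sum_(y | e x y) A i (enum_rank y).
Proof.
rewrite mulmxBr mul_mx_scalar mxE [X in X + _]mxE; congr (_ + _).
rewrite mxE; congr (- _); rewrite mxE.
rewrite (reindex _ (onW_bij _ (@enum_rank_bij V))) [RHS]big_mkcond /=.
apply: eq_bigr => y _; rewrite mxE !enum_rankK sym_e.
by case: e; rewrite ?mulr1 ?mulr0.
Qed.

Lemma trmx_laplacian : (laplacian R e r)^T = laplacian R e r.
Proof.
rewrite linearB /= tr_scalar_mx; congr (_ - _).
by apply/matrixP => i j; rewrite !mxE sym_e.
Qed.

(** Summation by parts: when the squares are expanded, symmetry and regularity of [e] turn both
    square sums into $r\sum_x g(x)^2$. *)
Lemma dirichlet_form (g : V -> R) :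
  \sum_x g x * (r%:R * g x - \sum_(y | e x y) g y) =
  (\sum_x \sum_(y | e x y) (g x - g y) ^+ 2) / 2.
Proof.
pose S := \sum_x \sum_(y | e x y) g x ^+ 2.
have S' : \sum_x \sum_(y | e x y) g y ^+ 2 = S.
  rewrite (exchange_big_dep predT) //=; apply: eq_bigr => y _.
  by apply: eq_bigl => x; exact: sym_e.
pose C := \sum_x \sum_(y | e x y) g x * g y.
have -> : \sum_x \sum_(y | e x y) (g x - g y) ^+ 2 = S + S - 2 * C.
  rewrite -{2}S' /S /C mulr_sumr -big_split -sumrB; apply: eq_bigr => x _ /=.
  rewrite mulr_sumr -big_split -sumrB; apply: eq_bigr => y _ /=; ring.
rewrite (_ : S + S - 2 * C = 2 * (S - C)); last by ring.
rewrite mulrAC mulfV ?pnatr_eq0 // mul1r -sumrB; apply: eq_bigr => x _.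
by rewrite sum_neighbours_cst mulrBr -mulr_sumr; congr (_ - _); ring.
Qed.

(** For an eigenvector $v$, [dirichlet_form] writes $a\|v\|^2$ as half a sum of squares. *)
Lemma eigenvalue_laplacian_ge0 a : eigenvalue (laplacian R e r) a -> 0 <= a.
Proof.
move=> /eigenvalueP[v vL v0].
have := dirichlet_form (fun x => v 0 (enum_rank x)).
have -> : \sum_x v 0 (enum_rank x) *
   (r%:R * v 0 (enum_rank x) - \sum_(y | e x y) v 0 (enum_rank y)) =
   a * \sum_x v 0 (enum_rank x) ^+ 2.
  rewrite mulr_sumr; apply: eq_bigr => x _.
  by rewrite -mulmx_laplacian vL mxE; ring.
have v2 : 0 < \sum_x v 0 (enum_rank x) ^+ 2.
  have /rV0Pn[i vi] := v0; rewrite (bigD1 (enum_val i)) //= enum_valK.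
  by rewrite ltr_pwDl ?sumr_ge0 // => [|j _];
    rewrite ?sqr_ge0 // exprn_even_gt0.
move=> av; rewrite -(pmulr_lge0 _ v2) av divr_ge0 //.
by apply: sumr_ge0 => x _; apply: sumr_ge0 => y _; exact: sqr_ge0.
Qed.

(** The Dirichlet energy of a harmonic function is zero, so it agrees across every edge and
    connectedness propagates this. *)
Lemma harmonic_cst (g : V -> R) :
  (forall x, r%:R * g x = \sum_(y | e x y) g y) -> forall x y, g x = g y.
Proof.
move=> harm; have /eqP := dirichlet_form g.
rewrite big1 => [|x _]; last by rewrite harm subrr mulr0.
rewrite eq_sym mulf_eq0 invr_eq0 pnatr_eq0 orbF.
rewrite psumr_eq0 => [/allP H|x _]; last first.
  by apply: sumr_ge0 => y _; exact: sqr_ge0.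
have He x y : e x y -> g x = g y.
  have := H x (mem_index_enum _); rewrite psumr_eq0 => [/allP Hx exy|z _];
    last exact: sqr_ge0.
  have := Hx y (mem_index_enum _); rewrite exy /= sqrf_eq0 subr_eq0 => /eqP //.
move=> x y; have /connectP[p] := conn_e x y.
elim: p x => [|z p IHp] x /= => [_ -> //|/andP[/He -> ezp]]; exact: IHp.
Qed.

Section Projections.
Variables (t : nat) (nu : 'I_t.+1 -> R).
Hypothesis nuP : distinct_eigenvalues (laplacian R e r) nu.
Hypothesis V_gt0 : (0 < #|V|)%N.
Local Notation E i x y := (laplacian_proj e r (nu i) x y).

Lemma laplacian_ones : const_mx 1 *m laplacian R e r = 0 :> 'rV_#|V|.
Proof.
apply/rowP => i; rewrite -(enum_valK i) mulmx_laplacian !mxE.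
under eq_bigr do rewrite mxE.
by rewrite sum_neighbours_cst subrr.
Qed.

Lemma nu0 : nu ord0 = 0.
Proof.
have [nu_lt nuE] := nuP; apply/eqP; rewrite eq_le; apply/andP; split;
  last first.
  by apply: eigenvalue_laplacian_ge0; apply/nuE; exists ord0.
have /nuE[i ->] : eigenvalue (laplacian R e r) 0.
  apply/eigenvalueP; exists (const_mx 1).
    by rewrite laplacian_ones scale0r.
  apply/rV0Pn; exists (Ordinal V_gt0); rewrite mxE; exact: oner_neq0.
have [->//|] := eqVneq i ord0; rewrite -lt0n => i0.
exact/ltW/(nu_lt ord0).
Qed.

Lemma nu_gt0 (i : 'I_t.+1) : (0 < i)%N -> 0 < nu i.
Proof. by move=> i0; rewrite -nu0; exact: nuP.1. Qed.

Lemma proj_sym i x y : E i x y = E i y x.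
Proof. by rewrite /laplacian_proj -[in LHS]orthoproj_sym mxE. Qed.

(** The rows of the projection are eigenvectors of the Laplacian, and symmetry transfers this to the
    columns. *)
Lemma proj_neighbours (i : 'I_t.+1) x y :
  \sum_(z | e x z) E i z y = (r%:R - nu i) * E i x y.
Proof.
rewrite proj_sym; under eq_bigr do rewrite proj_sym.
have /eigenspaceP/matrixP/(_ (enum_rank y) (enum_rank x)) :=
  orthoproj_sub (eigenspace (laplacian R e r) (nu i)).
rewrite mulmx_laplacian [X in _ = X]mxE => h.
by rewrite mulrBl -[X in _ - X]h opprB addrC subrK.
Qed.

(** The columns of $E_0$ are harmonic, hence constant; each sums to 1 because the projection fixes
    the all-ones vector. *)
Lemma proj0 x y : E ord0 x y = #|V|%:R^-1.
Proof.
have cst a b c : E ord0 a c = E ord0 b c.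
  apply: (@harmonic_cst (fun z => E ord0 z c)) => z.
  by rewrite proj_neighbours nu0 subr0.
pose J : 'rV[R]_#|V| := const_mx 1.
have := orthoproj_id (U := eigenspace (laplacian R e r) (nu ord0)) (W := J).
have /eigenspaceP -> : J *m laplacian R e r = nu ord0 *: J.
  by rewrite laplacian_ones nu0 scale0r.
move=> /(_ isT) /rowP /(_ (enum_rank y)); rewrite !mxE.
rewrite (reindex _ (onW_bij _ (@enum_rank_bij V))) /=.
under eq_bigr => z do rewrite mxE mul1r -/(E ord0 z y) (cst z x).
rewrite sumr_const => E1; apply: (mulfI (x := #|V|%:R)).
  by rewrite pnatr_eq0 -lt0n.
by rewrite mulr_natl mulfV ?pnatr_eq0 -?lt0n.
Qed.

Lemma sum_proj_pos x y :
  \sum_(i < t.+1 | (0 < i)%N) E i x y = (x == y)%:R - #|V|%:R^-1.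
Proof.
rewrite -(proj0 x y); apply/eqP; rewrite eq_sym subr_eq; apply/eqP.
have /matrixP/(_ (enum_rank x) (enum_rank y)) :=
  orthoproj_eigenspace_sum trmx_laplacian nuP.
rewrite summxE mxE (inj_eq enum_rank_inj) => <-.
rewrite (bigD1 ord0) //= addrC; congr (_ + _); apply: eq_bigl => i.
by rewrite lt0n.
Qed.

End Projections.
End Laplacian.

(** * Chebyshev polynomials at cosines, positivity of $D_{k,\nu}$, and cosine sums *)

Section Trigonometry.
Variable R : realType.
Implicit Types x : R.

Lemma horner_chebyshev_cos n x : (Defs.chebyshev R n).[cos x] = cos (n%:R * x).
Proof.
rewrite /Defs.chebyshev.
suff [] : (chebyshev_pair R n).1.[cos x] = cos (n%:R * x) /\
  (chebyshev_pair R n).2.[cos x] = cos (n.+1%:R * x) by [].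
elim: n => [|n] /=; first by rewrite hornerC hornerX mul0r cos0 mul1r.
case: chebyshev_pair => p q /= [pE qE]; split=> //.
rewrite !hornerE pE qE.
have -> : n.+2%:R * x = n.+1%:R * x + x by rewrite -natr1 mulrDl mul1r.
have -> : n%:R * x = n.+1%:R * x - x by rewrite -natr1 mulrDl mul1r addrK.
by rewrite cosB cosD; ring.
Qed.

(** In this form every summand is visibly nonnegative, which gives positivity for $\nu>0$ and, away
    from the trivial mode, for $\nu=0$. *)
Lemma DpolE k (nu x : R) :
  Dpol k nu (2 * cos x) = nu / 2 + \sum_(1 <= s < k.+1) (1 - cos (s%:R * x)).
Proof.
rewrite /Dpol sumrB sumr_const_nat subn1 /= addrA [nu / 2 + _]addrC.
congr (_ + _ - _); apply: eq_bigr => s _.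
by rewrite mulrAC mulfV ?pnatr_eq0 // mul1r horner_chebyshev_cos.
Qed.

Lemma Dpol_gt0 k (nu x : R) : 0 < nu -> 0 < Dpol k nu (2 * cos x).
Proof.
move=> nu0; rewrite DpolE ltr_pwDl ?divr_gt0 //.
by apply: sumr_ge0 => s _; rewrite subr_ge0 cos_le1.
Qed.

Lemma sin_frac_gt0 N j : (0 < j < N)%N -> 0 < sin (pi * j%:R / N%:R : R).
Proof.
move=> /andP[j0 jN]; have N0 : 0 < N%:R :> R by rewrite ltr0n (leq_trans _ jN).
apply: sin_gt0_pi; apply/andP; split.
  by rewrite divr_gt0 // mulr_gt0 ?pi_gt0 ?ltr0n.
by rewrite ltr_pdivrMr // ltr_pM2l ?pi_gt0 // ltr_nat.
Qed.

Lemma sum_cos_multiples N n : (n < N)%N ->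
  \sum_(0 <= j < N) cos (n%:R * (2 * pi * j%:R / N%:R)) =
  (N * (n == 0))%N%:R :> R.
Proof.
move=> nN; have [->|n0] := eqVneq n 0%N.
  rewrite (eq_bigr (fun=> 1)) => [|j _]; last by rewrite mul0r cos0.
  by rewrite sumr_const_nat subn0 muln1.
rewrite muln0; pose a : R := pi * n%:R / N%:R.
have N0 : (0 < N)%N by exact: leq_trans nN.
have N0' : N%:R != 0 :> R by rewrite pnatr_eq0 -lt0n.
have sina : sin a != 0 by rewrite gt_eqF // sin_frac_gt0 // lt0n n0.
apply: (mulfI sina); rewrite mulr0 mulr_sumr.
(* By $2\sin a\cos(2ja)=\sin((2j+1)a)-\sin((2j-1)a)$ the sum telescopes once multiplied by
   [sin a]. *)
pose f j : R := sin (2 * j%:R * a - a) / 2.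
rewrite (eq_bigr (fun j => f j.+1 - f j)) => [|j _].
  rewrite telescope_sumr // /f mulr0 mul0r sub0r sinN.
  (* Here $2Na=2\pi n$, so the two ends of the telescope agree by periodicity. *)
  have -> : 2 * N%:R * a - a = - a + pi *+ 2 *+ n.
    by rewrite /a; field.
  by rewrite (periodicn (@sinD2pi R)) sinN subrr.
have -> : n%:R * (2 * pi * j%:R / N%:R) = 2 * j%:R * a.
  by rewrite /a; ring.
have -> : f j.+1 = sin (2 * j%:R * a + a) / 2.
  by rewrite /f -natr1; congr (sin _ / _); ring.
by rewrite /f sinB sinD; field.
Qed.

(** The term $s=1$ equals $2\sin^2(\pi j/N)>0$. This justifies dividing by $D_{k,0}$ in every mode
    except $j=0$. *)
Lemma Dpol0_gt0 N k j : (0 < k)%N -> (0 < j < N)%N ->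
  0 < Dpol k 0 (2 * cos (2 * pi * j%:R / N%:R : R)).
Proof.
move=> k0 /andP[j0 jN]; rewrite DpolE mul0r add0r big_ltn // mul1r ltr_pwDl //.
  pose a : R := pi * j%:R / N%:R.
  have sina : 0 < sin a by rewrite sin_frac_gt0 // j0.
  have -> : 2 * pi * j%:R / N%:R = a *+ 2 by rewrite /a; ring.
  rewrite cos_mulr2n cos2sin2 (_ : _ - _ = sin a ^+ 2 *+ 2); last by ring.
  by rewrite pmulrn_lgt0 // exprn_gt0.
by apply: sumr_ge0 => s _; rewrite subr_ge0 cos_le1.
Qed.

End Trigonometry.

(** * Fourier cosine modes on $\mathbb Z_N$ *)

Section ZpCosines.
Variables (R : realType) (N : nat).
Hypothesis N_gt1 : (1 < N)%N.

Lemma ltn_Zp (x : 'Z_N) : (x < N)%N.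
Proof. by rewrite -[X in (_ < X)%N](Zp_cast N_gt1). Qed.

Lemma eq_Zp_nat (z : 'Z_N) s : (s < N)%N -> (z == s%:R) = (z == s :> nat).
Proof.
by move=> sN; rewrite -val_eqE /= val_Zp_nat // modn_small.
Qed.

Lemma eq_Zp_oppnat (z : 'Z_N) s :
  (0 < s < N)%N -> (z == - s%:R) = (N - z == s :> nat)%N.
Proof.
move=> sN; have zN := ltn_Zp z.
rewrite -addr_eq0 -{1}(natr_Zp z) -natrD -val_eqE /= val_Zp_nat //.
have [zs|zs] := ltnP (z + s) N; first by rewrite modn_small //; lia.
by rewrite -(subnK zs) modnDr modn_small; lia.
Qed.

Definition theta (j : nat) : R := 2 * pi * j%:R / N%:R.

(** Evaluated at the representative of [z] in $[0,N)$; [cos_modn] frees it from that choice. *)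
Definition Zcos (j : nat) (z : 'Z_N) : R := cos (z%:R * theta j).

Lemma cos_modn j n : cos ((n %% N)%N%:R * theta j) = cos (n%:R * theta j).
Proof.
rewrite [in RHS](divn_eq n N) natrD mulrDl.
rewrite (_ : _ * theta j + _ = (n %% N)%:R * theta j + pi *+ 2 *+ (n %/ N * j)).
  by rewrite (periodicn (@cosD2pi R)).
rewrite addrC; congr (_ + _); rewrite /theta; field.
by rewrite pnatr_eq0 -lt0n; exact: ltnW.
Qed.

Lemma Zcos_nat j n : Zcos j n%:R = cos (n%:R * theta j).
Proof. by rewrite /Zcos val_Zp_nat // cos_modn. Qed.

Lemma Zcos0 j : Zcos j 0 = 1.
Proof. by rewrite (Zcos_nat j 0) mul0r cos0. Qed.

(** A natural-number form of $-s$, to which [Zcos_nat] applies. *)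
Lemma oppr_Zp_nat s : - (s%:R) = (N.-1 * s)%:R :> 'Z_N.
Proof.
rewrite natrM (_ : N.-1%:R = -1) ?mulN1r //; apply/eqP.
by rewrite -addr_eq0 natr1 prednK ?pchar_Zp // ltnW.
Qed.

Lemma ZcosN j z : Zcos j (- z) = Zcos j z.
Proof.
rewrite -[z in LHS]natr_Zp oppr_Zp_nat Zcos_nat /Zcos.
rewrite (_ : _ * theta j = - (z%:R * theta j) + pi *+ 2 *+ (z * j)).
  by rewrite (periodicn (@cosD2pi R)) cosN.
rewrite natrM -subn1 natrB ?(ltnW N_gt1) // /theta; field.
by rewrite pnatr_eq0 -lt0n ltnW.
Qed.

(** The addition formulas for $\cos(\alpha\pm\beta)$ make each mode an eigenfunction of every
    symmetric pair of shifts. *)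
Lemma Zcos_neighbours j z s :
  Zcos j (z - s%:R) + Zcos j (z + s%:R) = 2 * cos (s%:R * theta j) * Zcos j z.
Proof.
rewrite -[z in LHS]natr_Zp oppr_Zp_nat -!natrD !Zcos_nat.
rewrite (_ : _ * theta j =
    (z%:R * theta j - s%:R * theta j) + pi *+ 2 *+ (s * j)).
  rewrite (periodicn (@cosD2pi R)) cosB natrD mulrDl cosD /Zcos; ring.
rewrite natrD natrM -subn1 natrB ?(ltnW N_gt1) // /theta; field.
by rewrite pnatr_eq0 -lt0n ltnW.
Qed.

Lemma sum_Zcos z : \sum_(0 <= j < N) Zcos j z = N%:R * (z == 0)%:R.
Proof. by rewrite sum_cos_multiples ?ltn_Zp // natrM. Qed.

End ZpCosines.

Lemma sum_eq_nat a n : (\sum_(1 <= s < n.+1) (a == s) = (0 < a <= n))%N.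
Proof.
elim: n => [|n IHn]; first by rewrite big_geq //; lia.
by rewrite big_nat_recr //= IHn; lia.
Qed.

(** * The circulant graph: neighbour sums and hitting function *)

Section Circulant.
Variables (R : realType) (N k : nat).
Hypotheses (k_gt0 : (0 < k)%N) (N_ge : (2 * k + 1 <= N)%N).

Let N_gt1 : (1 < N)%N. Proof. by move: k_gt0 N_ge; lia. Qed.

Local Notation theta := (theta R N).
Local Notation Zcos := (@Zcos R N).

Lemma exists_Zp_step (z : 'Z_N) :
  [exists s : 'I_k.+1, (0 < s)%N && ((z == s%:R) || (z == - s%:R))] =
  (0 < z <= k)%N || (0 < N - z <= k)%N.
Proof.
have zN := ltn_Zp N_gt1 z; apply/existsP/idP => [[[s /= sk]] /andP[s0]|].
  by rewrite (eq_Zp_nat N_gt1) ?(eq_Zp_oppnat N_gt1); lia.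
case/orP=> /andP[h0 hk].
  exists (Ordinal (hk : (z < k.+1)%N)).
  by rewrite /= (eq_Zp_nat N_gt1) // eqxx h0.
exists (Ordinal (hk : (N - z < k.+1)%N)); rewrite h0 (eq_Zp_oppnat N_gt1) /=;
  last by lia.
by rewrite eqxx orbT.
Qed.

(** Because $2k<N$, the $2k$ shifts by $\pm s$ reach distinct vertices, so the sum of indicators
    never exceeds 1. *)
Lemma circulantE (x y : 'Z_N) :
  (circulant k x y : nat) =
  (\sum_(1 <= s < k.+1) ((y == x - s%:R)%R + (y == x + s%:R)%R))%N.
Proof.
transitivity (\sum_(1 <= s < k.+1)
    ((x - y == s%:R)%R + (x - y == - s%:R)%R))%N.
  rewrite /circulant exists_Zp_step; move: (x - y) => z.
  have zN := ltn_Zp N_gt1 z.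
  transitivity ((0 < z <= k) + (0 < N - z <= k))%N; first by lia.
  rewrite -!sum_eq_nat -big_split /=; apply: eq_big_nat => s /andP[s0 sk].
  by rewrite (eq_Zp_nat N_gt1) ?(eq_Zp_oppnat N_gt1); lia.
apply: eq_bigr => s _.
have -> : (x - y == s%:R) = (y == x - s%:R).
  by rewrite [RHS]eq_sym !subr_eq addrC.
have -> // : (x - y == - s%:R) = (y == x + s%:R).
by rewrite subr_eq addrC eq_sym subr_eq.
Qed.

Lemma sum_circulant (g : 'Z_N -> R) x :
  \sum_(y | circulant k x y) g y =
  \sum_(1 <= s < k.+1) (g (x - s%:R) + g (x + s%:R)).
Proof.
rewrite big_mkcond /= (eq_bigr (fun y => \sum_(1 <= s < k.+1)
   ((y == x - s%:R)%:R * g y + (y == x + s%:R)%:R * g y))) => [|y _].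
  rewrite exchange_big /=; apply: eq_bigr => s _; rewrite big_split /=.
  rewrite (bigD1 (x - s%:R)) //= eqxx mul1r big1 ?addr0; last first.
    by move=> y /negPf ->; rewrite mul0r.
  rewrite (bigD1 (x + s%:R)) //= eqxx mul1r big1 ?addr0 //.
  by move=> y /negPf ->; rewrite mul0r.
transitivity ((circulant k x y : nat)%:R * g y).
  by case: ifP; rewrite ?mul1r ?mul0r.
rewrite circulantE natr_sum mulr_suml; apply: eq_bigr => s _.
by rewrite natrD mulrDl.
Qed.

(** On the right [nu] cancels against the $\nu/2$ inside [Dpol]; left free, it can be 0 for the
    circulant graph alone and $\nu_i$ for the product. *)
Lemma sum_circulant_Zcos j z (nu : R) :
  \sum_(y | circulant k z y) Zcos j y =
  (2 * k%:R + nu - 2 * Dpol k nu (2 * cos (theta j))) * Zcos j z.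
Proof.
rewrite sum_circulant; under eq_bigr do rewrite (Zcos_neighbours R N_gt1).
rewrite -mulr_suml; congr (_ * _); rewrite -mulr_sumr /Dpol mulrBr opprB.
have -> : 2 * cos (theta j) / 2 = cos (theta j) by field.
under [in RHS]eq_bigr do rewrite horner_chebyshev_cos.
by field.
Qed.

Lemma degree_circulant x : degree (circulant (N := N) k) x = (2 * k)%N.
Proof.
have := sum_circulant (fun=> 1) x.
rewrite sumr_const sumr_const_nat subn1 /= -mulr2n -mulrnA => /eqP.
by rewrite eqr_nat => /eqP.
Qed.

(* Fourier inversion on Z_N of the equation h = 1 + P h off 0. *)
Definition circulant_hitting (z : 'Z_N) : R :=
  k%:R * \sum_(1 <= j < N) (1 - Zcos j z) / Dpol k 0 (2 * cos (theta j)).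

Lemma circulant_hitting0 : circulant_hitting 0 = 0.
Proof.
rewrite /circulant_hitting big1 ?mulr0 // => j _.
by rewrite (Zcos0 R N_gt1) subrr mul0r.
Qed.

Lemma sum_circulant_hitting z :
  \sum_(y | circulant k z y) circulant_hitting y =
  2 * k%:R * (circulant_hitting z - 1 + N%:R * (z == 0)%:R).
Proof.
rewrite -mulr_sumr exchange_big /=.
(* The neighbour sum of $1-\cos$ is $2k(1-\cos)+2D\cos$ in each mode, and dividing by $D$ leaves a
   bare cosine. *)
rewrite (eq_big_nat _ _ (F2 := fun j =>
   2 * k%:R * ((1 - Zcos j z) / Dpol k 0 (2 * cos (theta j))) +
   2 * Zcos j z)); last first.
  move=> j jN; have D0 := Dpol0_gt0 R k_gt0 jN; rewrite -/(theta j) in D0.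
  rewrite -mulr_suml sumrB sumr_const (sum_circulant_Zcos _ _ 0).
  rewrite (_ : #|_| = 2 * k)%N; last exact: degree_circulant.
  by field; rewrite gt_eqF.
rewrite big_split -!mulr_sumr /=.
(* The absent mode $j=0$ is the source of the constant $-1$ in the hitting equation. *)
have -> : \sum_(1 <= j < N) Zcos j z = N%:R * (z == 0)%:R - 1.
  rewrite -(sum_Zcos R N_gt1) [in RHS]big_ltn ?(ltnW N_gt1) //.
  by rewrite /Zcos /theta !(mulr0, mul0r) cos0 addrC addKr.
by rewrite /circulant_hitting; ring.
Qed.
End Circulant.

(** * Neighbour sums in regular graphs and Cartesian products; translations *)

Lemma sum_transition (R : realType) (V : finType) (e : rel V) d (g : V -> R) x :
  regular_graph e d ->
  \sum_y transition e x y * g y = (\sum_(y | e x y) g y) / d%:R.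
Proof.
move=> reg_e; rewrite [in RHS]big_mkcond mulr_suml; apply: eq_bigr => y _.
by rewrite /transition reg_e; case: ifP => _; rewrite ?mul0r // mulrC.
Qed.

(** Irreflexivity keeps the two families of neighbours disjoint: a common one would be a loop at
    [u]. *)
Lemma sum_cartesian_product (M : nmodType) (V W : finType) (e : rel V)
    (f : rel W) (g : V * W -> M) u :
  irreflexive e -> irreflexive f ->
  \sum_(v | cartesian_product e f u v) g v =
  \sum_(y | e u.1 y) g (y, u.2) + \sum_(c | f u.2 c) g (u.1, c).
Proof.
case: u => x b irr_e irr_f; rewrite /cartesian_product /= big_mkcond /=.
rewrite (eq_bigr (fun v => (if (v.2 == b) && e x v.1 then g v else 0) +
    (if (v.1 == x) && f b v.2 then g v else 0))); last first.
  move=> [y c] _ /=; rewrite (eq_sym b) (eq_sym x).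
  case: (eqVneq c b) => [->|_]; case: (eqVneq y x) => [->|_] /=;
    by rewrite ?irr_e ?irr_f /= ?orbF ?addr0 ?add0r.
rewrite big_split /=; congr (_ + _).
  transitivity (\sum_y \sum_c (if (c == b) && e x y then g (y, c) else 0)).
    by rewrite pair_bigA; apply: eq_bigr => -[].
  rewrite [RHS]big_mkcond; apply: eq_bigr => y _ /=.
  by rewrite (bigD1 b) //= eqxx big1 ?addr0 // => c /negPf ->.
transitivity (\sum_y \sum_c (if (y == x) && f b c then g (y, c) else 0)).
  by rewrite pair_bigA; apply: eq_bigr => -[].
rewrite [RHS]big_mkcond (bigD1 x) //= eqxx [X in _ + X]big1 ?addr0 //.
by move=> y /negPf yx; rewrite big1 // => c _; rewrite yx.
Qed.

Lemma degree_cartesian_product (V W : finType) (e : rel V) (f : rel W) p q :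
  irreflexive e -> irreflexive f ->
  regular_graph e p -> regular_graph f q ->
  regular_graph (cartesian_product e f) (p + q).
Proof.
move=> irr_e irr_f reg_e reg_f u.
have /eqP := sum_cartesian_product (fun=> 1 : rat) u irr_e irr_f.
rewrite !sumr_const -natrD eqr_nat => /eqP; rewrite -(reg_e u.1) -(reg_f u.2).
exact.
Qed.

Section CirculantShift.
Variables (R : realType) (N k : nat).
Hypotheses (k_gt0 : (0 < k)%N) (N_ge : (2 * k + 1 <= N)%N).

(** Translation invariance, used to move the target of the walk to 0. *)
Lemma sum_circulant_shift (g : 'Z_N -> R) x c :
  \sum_(y | circulant k x y) g (y - c) = \sum_(y | circulant k (x - c) y) g y.
Proof.
rewrite (sum_circulant k_gt0 N_ge (fun y => g (y - c))).
rewrite (sum_circulant k_gt0 N_ge).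
by apply: eq_bigr => s _; rewrite [x - c - _]addrAC [x - c + _]addrAC.
Qed.

Lemma circulant_irreflexive : irreflexive (circulant (N := N) k).
Proof.
move=> x; rewrite /circulant subrr exists_Zp_step //= subn0; lia.
Qed.

End CirculantShift.

(** * Hitting function of the product graph *)

Section ProductHitting.
Variables (R : realType) (N k : nat).
Hypotheses (k_gt0 : (0 < k)%N) (N_ge : (2 * k + 1 <= N)%N).
Variables (V : finType) (e : rel V) (r t : nat) (nu : 'I_t.+1 -> R) (b : V).
Hypotheses (simple_e : simple_graph e) (conn_e : connected_graph e).
Hypothesis reg_e : regular_graph e r.
Hypothesis nuP : distinct_eigenvalues (laplacian R e r) nu.

Let N_gt1 : (1 < N)%N. Proof. by move: k_gt0 N_ge; lia. Qed.

Local Notation E i x y := (laplacian_proj e r (nu i) x y).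
Local Notation D i j := (Dpol k (nu i) (2 * cos (theta R N j))).
Local Notation m := #|V|.

(** The claimed value of $h_X$ for the target $(0,b)$, as a function of the start [u]. *)
Definition product_hitting (u : 'Z_N * V) : R :=
  (2 * k + r)%N%:R / (2 * k)%N%:R * circulant_hitting R k u.1 +
  (m * (2 * k + r))%N%:R / 2 *
  \sum_(i < t.+1 | (0 < i)%N) \sum_(0 <= j < N)
    (E i b b - E i u.2 b * Zcos R j u.1) / D i j.

Lemma product_hitting_target : product_hitting (0, b) = 0.
Proof.
rewrite /product_hitting (circulant_hitting0 R k_gt0 N_ge) mulr0 add0r.
rewrite big1 ?mulr0 // => i _.
by rewrite big1 // => j _; rewrite (Zcos0 R N_gt1) mulr1 subrr mul0r.
Qed.

Let V_gt0 : (0 < m)%N. Proof. by apply/card_gt0P; exists b. Qed.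

Lemma sum_product_hitting u :
  \sum_(v | cartesian_product (circulant (N := N) k) e u v) product_hitting v =
  (2 * k + r)%N%:R *
    (product_hitting u - 1 + (m * N)%N%:R * (u == (0, b))%:R).
Proof.
have irr_e : irreflexive e by case: simple_e.
rewrite sum_cartesian_product //; last exact: circulant_irreflexive.
case: u => z c /=; rewrite /product_hitting /=.
set K := _%:R / 2.
have sumC_cst a : \sum_(y | circulant k z y) a = 2 * k%:R * a :> R.
  by rewrite (sum_neighbours_cst (degree_circulant R k_gt0 N_ge)) natrM.
have lin (I : finType) (P : pred I) (c1 c2 : R) f g :
    \sum_(i | P i) (c1 * f i + c2 * g i) =
    c1 * (\sum_(i | P i) f i) + c2 * (\sum_(i | P i) g i).
  by rewrite big_split -!mulr_sumr.
rewrite !lin (sum_circulant_hitting R k_gt0 N_ge) (sum_neighbours_cst reg_e).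
have D0 (i : 'I_t.+1) j : (0 < i)%N -> D i j != 0.
  by move=> i0; rewrite gt_eqF // Dpol_gt0 // (nu_gt0 simple_e reg_e nuP).
(* A mode is multiplied by $2k+\nu_i-2D$ along the circulant graph and by $r-\nu_i$ along [e]. In
   the total $2k+r-2D$ the last term cancels the denominator and leaves cosines summing to
   $N[z=0]$. *)
have combine (i : 'I_t.+1) : (0 < i)%N ->
    \sum_(y | circulant k z y) \sum_(0 <= j < N)
      (E i b b - E i c b * Zcos R j y) / D i j +
    \sum_(c' | e c c') \sum_(0 <= j < N)
      (E i b b - E i c' b * Zcos R j z) / D i j =
    (2 * k + r)%N%:R *
      (\sum_(0 <= j < N) (E i b b - E i c b * Zcos R j z) / D i j) +
    2 * E i c b * (N%:R * (z == 0)%:R).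
  move=> i0; rewrite exchange_big [X in _ + X]exchange_big -big_split /=.
  rewrite -(sum_Zcos R N_gt1) !mulr_sumr -big_split /=; apply: eq_bigr => j _.
  rewrite -!mulr_suml !sumrB sumC_cst (sum_neighbours_cst reg_e).
  rewrite -mulr_sumr -mulr_suml.
  rewrite (sum_circulant_Zcos k_gt0 N_ge j z (nu i)).
  rewrite (proj_neighbours r simple_e) natrD natrM.
  by field; exact: D0.
set A := (X in _ + _ * X + _ = _); set B := (X in _ + (_ + _ * X) = _).
set S := (X in _ = _ * (_ + _ * X - _ + _)).
have SE : A + B = (2 * k + r)%N%:R * S +
    2 * ((c == b)%:R - m%:R^-1) * (N%:R * (z == 0)%:R).
  rewrite /A /B exchange_big [X in _ + X]exchange_big -big_split /=.
  rewrite (eq_bigr _ combine) big_split /= -mulr_suml -!mulr_sumr.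
  by rewrite (sum_proj_pos simple_e conn_e reg_e nuP).
have -> : A = (2 * k + r)%N%:R * S +
    2 * ((c == b)%:R - m%:R^-1) * (N%:R * (z == 0)%:R) - B by rewrite -SE addrK.
(* The circulant part contributes $(2k+r)N[z=0]$; the $-1/m$ of the projections removes it, leaving
   $(2k+r)mN$ at $(0,b)$ alone. *)
rewrite xpair_eqE -mulnb /K !natrM natrD natrM.
by field; rewrite !pnatr_eq0 -!lt0n k_gt0.
Qed.
End ProductHitting.

(** The walks are arbitrary realisations on unrelated probability spaces. Finiteness of [hC] is
    asserted too, so that the extended-real identity is one between real numbers. *)
Theorem corollary3p4 (R : realType) (N k m r t : nat)
    (V : finType) (e : rel V) (nu : 'I_t.+1 -> R)
    (dC : measure_display) (OmegaC : measurableType dC)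
    (PC : probability OmegaC R) (ZC : nat -> OmegaC -> 'Z_N)
    (dX : measure_display) (OmegaX : measurableType dX)
    (PX : probability OmegaX R) (ZX : nat -> OmegaX -> 'Z_N * V)
    (a b : V) (l : nat) :
  (0 < k)%N -> (2 * k + 1 <= N)%N ->
  #|V| = m -> simple_graph e -> connected_graph e -> regular_graph e r ->
  distinct_eigenvalues (laplacian R e r) nu ->
  (l < N)%N ->
  simple_random_walk (circulant (N := N) k) PC ZC 0 ->
  simple_random_walk (cartesian_product (circulant (N := N) k) e) PX ZX (0, a) ->
  let hC := hitting_time PC ZC (l%:R) in
  let hX := hitting_time PX ZX (l%:R, b) in
  let theta (j : nat) : R := 2 * pi * j%:R / N%:R in
  let E (i : 'I_t.+1) (x y : V) : R :=
    orthoproj (eigenspace (laplacian R e r) (nu i)) (enum_rank x) (enum_rank y) in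
  hC \is a fin_num /\
  hX = (((2 * k + r)%N%:R / (2 * k)%N%:R)%:E * hC +
        ((m * (2 * k + r))%N%:R / 2 *
         \sum_(i < t.+1 | (0 < i)%N) \sum_(0 <= j < N)
           (E i b b - E i a b * cos (l%:R * theta j)) /
           Dpol k (nu i) (2 * cos (theta j)))%:E)%E.
Proof.
move=> k_gt0 N_ge card_V simple_e conn_e reg_e nuP lN walkC walkX hC hX theta E.
have N_gt1 : (1 < N)%N by lia.
have kN0 : (2 * k)%:R != 0 :> R by rewrite pnatr_eq0; lia.
have krN0 : (2 * k + r)%:R != 0 :> R by rewrite pnatr_eq0; lia.
have hCE : hC = (circulant_hitting R k (0 - l%:R : 'Z_N))%:E.
  (* Translation by $-\ell$ brings the target to 0 and the start to $-\ell$. *)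
  pose g (z : 'Z_N) := circulant_hitting R k (z - l%:R).
  apply: (hitting_time_solution walkC (g := g)).
    by rewrite /g subrr circulant_hitting0.
  move=> x xl; rewrite (sum_transition _ _ (degree_circulant R k_gt0 N_ge)).
  rewrite (sum_circulant_shift k_gt0 N_ge) (sum_circulant_hitting R k_gt0 N_ge).
  rewrite subr_eq0 (negPf xl) mulr0 addr0 -natrM mulrAC mulfV // mul1r.
  by rewrite addrC subrK.
have hXE : hX = (product_hitting k e r nu b (0 - l%:R : 'Z_N, a))%:E.
  pose g (u : 'Z_N * V) := product_hitting k e r nu b (u.1 - l%:R, u.2).
  have g_target : g (l%:R, b) = 0.
    by rewrite /g /= subrr product_hitting_target.
  have irr_e : irreflexive e by case: simple_e.
  have irr_C := circulant_irreflexive k_gt0 N_ge.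
  apply: (hitting_time_solution walkX g_target) => -[x c] xl.
  rewrite (sum_transition _ _ (degree_cartesian_product irr_C irr_e
    (degree_circulant R k_gt0 N_ge) reg_e)).
  have -> : \sum_(v | cartesian_product (circulant (N := N) k) e (x, c) v) g v =
      \sum_(v | cartesian_product (circulant (N := N) k) e (x - l%:R, c) v)
        product_hitting k e r nu b v.
    rewrite !sum_cartesian_product //=; congr (_ + _).
    exact: (sum_circulant_shift k_gt0 N_ge
      (fun z => product_hitting k e r nu b (z, c))).
  rewrite (sum_product_hitting k_gt0 N_ge) // xpair_eqE subr_eq0.
  rewrite -[_ && _]/((x, c) == (l%:R, b)).
  by rewrite (negPf xl) mulr0 addr0 mulrAC mulfV // mul1r addrC subrK.
rewrite hCE hXE; split=> //; rewrite -EFinM -EFinD /product_hitting -card_V.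
congr (_ + _ * _)%:E.
apply: eq_bigr => i _; apply: eq_bigr => j _ /=.
(* Evenness of the cosine turns the translated start $-\ell$ back into $\ell$. *)
by rewrite sub0r (ZcosN R N_gt1) (Zcos_nat R N_gt1).
Qed.
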